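(* Let $D>0$, let $(\mathcal X,\|\cdot\|)$ be a $(2,D)$-smooth separable Banach space, and let $f\in\mathcal M(\mathcal X)$ be such that $\|S_2\|_\infty\le b$ for some $b>0$ and, for each $j=1,2,\ldots$, the increment $d_j$ is $F_{j-1}$-conditionally symmetrically distributed. Then for all $r\ge0$, $$\mathbf{Pr}(f^*\ge r)\le 2\exp\left\{-\frac{r^2}{2D^2b^2}\right\}.$$
   Context: A real Banach space $(\mathcal X,\|\cdot\|)$ is called $(2,D)$-smooth if $\|x+y\|^2+\|x-y\|^2\le 2\|x\|^2+2D^2\|y\|^2$ for all $x,y\in\mathcal X$. For a separable Banach space $\mathcal X$, $\mathcal M(\mathcal X)$ is the class of all martingales $f=(f_0,f_1,\ldots)$ of Bochner-integrable random vectors in $\mathcal X$ with $f_0\equiv 0$, defined on some probability space with respect to some filtration $(F_0,F_1,\ldots)$ (both may depend on $f$). Put $d_j=f_j-f_{j-1}$ for $j\ge1$, $f^*=\sup_{j\ge0}\|f_j\|$, $S_2=\left(\sum_{j=1}^\infty\|d_j\|^2\right)^{1/2}$; $\|\cdot\|_\infty$ of a real random variable is its essential supremum norm. ''$d_j$ is $F_{j-1}$-conditionally symmetrically distributed'' means that the conditional distributions of $d_j$ and $-d_j$ given $F_{j-1}$ coincide almost surely. *)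

(* Defs.v *)
From HB Require Import structures.
From mathcomp Require Import all_boot all_order all_algebra.
From mathcomp Require Import all_classical all_reals all_analysis.

Set Implicit Arguments.
Unset Strict Implicit.
Unset Printing Implicit Defensive.

Import Order.TTheory GRing.Theory Num.Theory.
Import numFieldNormedType.Exports.

Local Open Scope classical_set_scope.
Local Open Scope ring_scope.

Definition smooth2 (R : realType) (V : normedModType R) (D : R) : Prop :=
  forall x y : V,
    `|x + y| ^+ 2 + `|x - y| ^+ 2 <= 2 * `|x| ^+ 2 + 2 * D ^+ 2 * `|y| ^+ 2.

Definition separable (V : topologicalType) : Prop :=
  exists2 S : set V, countable S & dense S.

(* A copy of [V] carrying the Borel sigma-algebra. *)
Definition borel (R : realType) (V : normedModType R) :=
  g_sigma_algebraType (@open V).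

Section bochner.
Context d (T : measurableType d) (R : realType) (P : probability T R).
Context (V : completeNormedModType R).

Definition simple_vector (s : T -> V) : Prop :=
  finite_set (range s) /\ forall v, measurable (s @^-1` [set v]).

Definition simple_integral (A : set T) (s : T -> V) : V :=
  \sum_(v \in range s) fine (P (A `&` s @^-1` [set v])) *: v.

Definition bochner_integrable (X : T -> V) : Prop :=
  exists s : nat -> T -> V,
    [/\ forall n, simple_vector (s n),
        {ae P, forall t, s n t @[n --> \oo] --> X t} &
        (\int[P]_t (`|X t - s n t|%:E))%E @[n --> \oo] --> 0%E].

Definition is_bochner_integral (A : set T) (X : T -> V) (v : V) : Prop :=
  exists s : nat -> T -> V,
    [/\ forall n, simple_vector (s n),
        (\int[P]_(t in A) (`|X t - s n t|%:E))%E @[n --> \oo] --> 0%E &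
        simple_integral A (s n) @[n --> \oo] --> v].

(* The limit [v] does not depend on the approximating sequence, and it exists
   for measurable [A] and Bochner integrable [X]; the junk value is 0. *)
Definition bochner_integral (A : set T) (X : T -> V) : V :=
  xget 0 [set v | is_bochner_integral A X v].

End bochner.

Section martingale.
Context d (T : measurableType d) (R : realType) (P : probability T R).
Context (V : completeNormedModType R).

Definition filtration (F : nat -> set (set T)) : Prop :=
  [/\ forall n, sigma_algebra setT (F n),
      forall n, F n `<=` measurable &
      forall n, F n `<=` F n.+1].

(* As [G] is a sigma-algebra in all uses below, the measurable sets of
   [g_sigma_algebraType G] are exactly the elements of [G]. *)
Definition measurable_wrt (G : set (set T)) (X : T -> V) : Prop :=
  measurable_fun setT (X : g_sigma_algebraType G -> borel V).

(* [Y] is a version of E[X | G]. *)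
Definition is_cond_exp (G : set (set T)) (X Y : T -> V) : Prop :=
  [/\ measurable_wrt G Y, bochner_integrable P Y &
      forall A, G A -> bochner_integral P A Y = bochner_integral P A X].

Definition martingale (F : nat -> set (set T)) (f : nat -> T -> V) : Prop :=
  [/\ filtration F,
      forall n, measurable_wrt (F n) (f n),
      forall n, bochner_integrable P (f n) &
      forall n, is_cond_exp (F n) (f n.+1) (f n)].

(* [k] is a regular conditional distribution of [X] given [G]. *)
Definition is_cond_distr (G : set (set T)) (X : T -> V)
    (k : R.-pker (g_sigma_algebraType G) ~> (borel V)) : Prop :=
  forall (A : set T) (B : set (borel V)), G A -> measurable B ->
    (\int[P]_(t in A) k t B = P (A `&` X @^-1` B))%E.

(* For separable [V] (a Polish space) regular conditional distributions always
   exist and are unique up to a null set, so the existential quantifiers add no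
   requirement on [X]. *)
Definition cond_symmetric (G : set (set T)) (X : T -> V) : Prop :=
  exists k1 k2 : R.-pker (g_sigma_algebraType G) ~> (borel V),
    [/\ is_cond_distr X k1, is_cond_distr (fun t => - X t) k2 &
        {ae P, forall t, forall B : set (borel V), measurable B ->
           k1 t B = k2 t B}].

Definition incr (f : nat -> T -> V) (j : nat) (t : T) : V :=
  f j t - f j.-1 t.

Definition maximal (f : nat -> T -> V) (t : T) : \bar R :=
  ereal_sup [set `|f j t|%:E | j in [set: nat]].

Definition square_fun (f : nat -> T -> V) (t : T) : \bar R :=
  sqrte (\sum_(1 <= j <oo) (`|incr f j t| ^+ 2)%:E)%E.

End martingale.

(* Main.v *)
Require Import Defs.
From HB Require Import structures.
From mathcomp Require Import all_boot all_order all_algebra.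
From mathcomp Require Import all_classical all_reals all_analysis.
From mathcomp Require Import measurable_realfun ess_sup_inf ring lra.
Import Order.TTheory GRing.Theory Num.Theory.
Import numFieldNormedType.Exports.
Local Open Scope classical_set_scope.
Local Open Scope ring_scope.

(** The proof is Pinelis's exponential supermartingale argument.  For [l >= 0]
let
   [G_n = cosh (l |f_n|) exp (- l^2 D^2 (|d_1|^2 + ... + |d_n|^2) / 2)].
The geometry of the space enters only through [smooth2_cosh],
   [cosh (l |x + y|) + cosh (l |x - y|)
      <= 2 cosh (l |x|) exp (l^2 D^2 |y|^2 / 2)],
the analogue for [cosh] of the defining inequality of (2,D)-smoothness.
Conditional symmetry allows replacing [d_(n+1)] by [- d_(n+1)] when
integrating any nonnegative function of [d_(n+1)] and of the past
([cond_symmetric_integral]).  Averaging over the two signs and using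
[smooth2_cosh] with [x = f_n], [y = d_(n+1)] shows that the integral of
[G_(n+1)] over a set of the [n]-th sigma-algebra is at most that of [G_n]
([cosh_process_step]).  The whole quadratic variation can be compensated
path by path, rather than in conditional mean, because the bound for a fixed
pair of signs holds for each value of [d_(n+1)].

Where [|f_n| >= rho], the hypothesis on [S_2] yields almost surely
[G_n >= exp (l rho) / 2 * exp (- l^2 D^2 b^2 / 2)], while [G_0 = 1].  Doob's
maximal inequality ([nonneg_supermartingale_exit]) then bounds the probability
that [|f_n|] ever reaches [rho] by [2 exp (l^2 D^2 b^2 / 2 - l rho)], and
[l = r / (D^2 b^2)] is optimal when [rho = r].  As [f^* >= r] only ensures that
every level [rho < r] is reached, the bound at [r] is obtained by letting
[rho] increase to [r] ([le_expR_of_lt]). *)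

Set Implicit Arguments.
Unset Strict Implicit.

(** * Hyperbolic cosine and smoothness *)

Definition cosh {R : realType} (x : R) : R := (expR x + expR (- x)) / 2.

Lemma cosh_gt0 {R : realType} (x : R) : 0 < cosh x.
Proof. by rewrite divr_gt0 ?addr_gt0 ?expR_gt0. Qed.

Lemma expR_le_cosh {R : realType} (x : R) : expR x / 2 <= cosh x.
Proof. by rewrite ler_pM2r ?invr_gt0// lerDl expR_ge0. Qed.

Lemma cosh0 {R : realType} : cosh (0 : R) = 1.
Proof. by rewrite /cosh oppr0 expR0; field. Qed.

Lemma coshN {R : realType} (x : R) : cosh (- x) = cosh x.
Proof. by rewrite /cosh opprK addrC. Qed.

(** This is [tanh x <= x], cleared of denominators. *)
Lemma sinh_le_mul_cosh {R : realType} (x : R) : 0 <= x ->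
  expR x - expR (- x) <= x * (expR x + expR (- x)).
Proof.
move=> x0; pose g (t : R) := (t - 1) * expR t + (t + 1) * expR (- t).
have dg (t : R) : is_derive t 1 g (t * (expR t - expR (- t))).
  by apply: is_derive_eq; rewrite /GRing.scale/=; ring.
suff : g 0 <= g x by rewrite /g oppr0 expR0; lra.
apply: (@ger0_derive1_le_cc _ g 0 x) => //=.
- move=> t; rewrite in_itv/= => /andP[t0 _]; rewrite derive1E derive_val.
  by rewrite mulr_ge0 ?subr_ge0 ?ler_expR ?ltW//; lra.
- by apply: derivable_within_continuous => t _; exact: ex_derive.
- by rewrite in_itv/= lexx.
- by rewrite in_itv/= x0 lexx.
Qed.

(** The logarithmic derivative of [cosh] is [tanh t <= t], so
[cosh t * exp (- t^2 / 2)] is nonincreasing for [t >= 0]. *)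
Lemma cosh_growth {R : realType} {x p : R} : 0 <= x -> x <= p ->
  cosh p <= cosh x * expR ((p ^+ 2 - x ^+ 2) / 2).
Proof.
move=> x0 xp; pose g (t : R) := cosh t * expR (- (t ^+ 2 / 2)).
have dg (t : R) : is_derive t 1 g (expR (- (t ^+ 2 / 2)) / 2 *
    ((expR t - expR (- t)) - t * (expR t + expR (- t)))).
  by rewrite /g /cosh; apply: is_derive_eq; rewrite /GRing.scale/=; field.
have gpx : g p <= g x.
  apply: (@ler0_derive1_le_cc _ g x p) => //=.
  - move=> t; rewrite in_itv/= => /andP[xt _]; rewrite derive1E derive_val.
    rewrite mulr_ge0_le0 ?divr_ge0 ?expR_ge0// subr_le0.
    by apply: sinh_le_mul_cosh; rewrite (le_trans x0)// ltW.
  - by apply: derivable_within_continuous => t _; exact: ex_derive.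
  - by rewrite in_itv/= xp lexx.
  - by rewrite in_itv/= lexx.
rewrite mulrBl addrC [leRHS]mulrC expRD mulrC mulrA -ler_pdivrMr ?expR_gt0//.
by rewrite -expRN mulrC; rewrite /g in gpx; lra.
Qed.

Lemma cosh_le_expR {R : realType} (x : R) : cosh x <= expR (x ^+ 2 / 2).
Proof.
wlog x0 : x / 0 <= x => [h|].
  by case: (leP 0 x) => [/h//|x0]; rewrite -coshN -sqrrN h// oppr_ge0 ltW.
by have := cosh_growth (lexx 0) x0; rewrite cosh0 mul1r expr0n subr0.
Qed.

Lemma coshDB {R : realType} (a b : R) :
  cosh (a + b) + cosh (a - b) = 2 * (cosh a * cosh b).
Proof. by rewrite /cosh !opprD opprK !expRD; field. Qed.

(** With [p] and [q] the half sum and the half difference of [|x + y|] and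
[|x - y|], the left-hand side is [2 cosh (l p) cosh (l q)], smoothness reads
[p^2 + q^2 <= |x|^2 + D^2 |y|^2], and [p >= |x|] by the triangle inequality.
Growing [cosh] from [l |x|] to [l p] costs a factor
[exp (l^2 (p^2 - |x|^2) / 2)] and [cosh (l q)] is at most
[exp (l^2 q^2 / 2)]: the exponents add up to at most
[l^2 D^2 |y|^2 / 2]. *)
Lemma smooth2_cosh {R : realType} {V : normedModType R} (D l : R) (x y : V) :
  smooth2 V D -> 0 <= l ->
  cosh (l * `|x + y|) + cosh (l * `|x - y|) <=
  2 * (cosh (l * `|x|) * expR (l ^+ 2 * D ^+ 2 * `|y| ^+ 2 / 2)).
Proof.
move=> smV l0; pose p : R := (`|x + y| + `|x - y|) / 2.
pose q : R := (`|x + y| - `|x - y|) / 2.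
have xp : `|x| <= p.
  have : `|(x + y) + (x - y)| <= `|x + y| + `|x - y| := ler_normD _ _.
  have -> : (x + y) + (x - y) = x *+ 2 by rewrite addrACA subrr addr0 mulr2n.
  by rewrite normrMn /p; lra.
have pq : p ^+ 2 + q ^+ 2 <= `|x| ^+ 2 + D ^+ 2 * `|y| ^+ 2.
  by have := smV x y; rewrite /p /q; lra.
have -> : l * `|x + y| = l * p + l * q by rewrite /p /q; field.
have -> : l * `|x - y| = l * p - l * q by rewrite /p /q; field.
rewrite coshDB ler_pM2l//.
have := cosh_growth (mulr_ge0 l0 (normr_ge0 x)) (ler_wpM2l l0 xp).
have := cosh_le_expR (l * q) => hq hp.
apply: le_trans (ler_pM (ltW (cosh_gt0 _)) (ltW (cosh_gt0 _)) hp hq) _.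
rewrite -[leLHS]mulrA -expRD ler_pM2l ?cosh_gt0// ler_expR.
have := ler_wpM2l (sqr_ge0 l) pq.
by rewrite !exprMn; lra.
Qed.

(** * Borel measurability in a separable normed space *)

Lemma borel_continuous_measurable {R : realType} {V W : normedModType R}
    (g : V -> W) : continuous g ->
  measurable_fun setT (g : borel V -> borel W).
Proof.
move=> cg; apply: (@measurability _ _ (borel V) (borel W) setT g
  (@open W)) => //.
move=> _ [U oU <-]; rewrite setTI; apply: sub_sigma_algebra.
exact: ((continuousP g).1 cg _ oU).
Qed.

Lemma borel_norm_measurable {R : realType} {V : normedModType R} :
  measurable_fun setT (fun x : borel V => `|(x : V)|).
Proof.
apply: (@measurability _ _ (borel V) R setT _ _
  (RGenOpens.measurableE R)).
move=> _ [_ [x [y ->]] <-]; rewrite setTI; apply: sub_sigma_algebra.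
exact: ((continuousP (Num.norm : V -> R)).1 (@norm_continuous _ _) _
  (itv_open x y)).
Qed.

Lemma separable_seq {R : realType} {V : normedModType R} :
  separable V -> exists s : nat -> V, forall (x : V) (e : R), 0 < e ->
    exists n, `|s n - x| < e.
Proof.
move=> [S /pfcard_geP[->|[s]] dS].
  have /(_ (ex_intro _ 0 I) openT)[x []//] := dS setT.
exists s => x e e0.
have [y] := dS (ball x e) (ex_intro _ x (ballxx x e0)) (ball_open x e).
move=> [xy /(@surj _ _ _ _ s)[n _ sny]]; exists n.
by rewrite sny distrC; move: xy; rewrite -ball_normE.
Qed.

Lemma norm_addB_lt4 {R : realType} {V : normedModType R}
    {a b x y x' y' : V} {e : R} :
  `|a - x| < e -> `|b - y| < e -> `|a - x'| < e -> `|b - y'| < e ->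
  `|x + y - (x' + y')| < e * 4.
Proof.
move=> ax by_ ax' by'.
rewrite (_ : x + y - (x' + y') = (a - x') - (a - x) + ((b - y') - (b - y))).
  apply: le_lt_trans (ler_normD _ _) _.
  have := ler_normB (a - x') (a - x).
  have := ler_normB (b - y') (b - y).
  lra.
have dist (c z z' : V) : c - z' - (c - z) = z - z'.
  by rewrite opprB addrC addrA subrK.
by rewrite !dist opprD addrACA.
Qed.

(** The source carries the product of the Borel sigma-algebras, which in
general is smaller than the Borel sigma-algebra of the product, so continuity
of the addition is not enough.  Separability makes the inverse image of an
open set a countable union of products of balls. *)
Lemma borel_add_measurable {R : realType} {V : normedModType R} :
  separable V ->
  measurable_fun setT
    ((fun z => (z.1 : V) + z.2) : (borel V * borel V)%type -> borel V).
Proof.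
move=> /separable_seq[s sP].
apply: (@measurability _ _ (borel V * borel V)%type (borel V) setT _
  (@open V)) => //.
move=> _ [U oU <-]; rewrite setTI.
pose good (p : nat * nat * nat) := forall x y : V,
  `|s p.1.1 - x| < p.2.+1%:R^-1 -> `|s p.1.2 - y| < p.2.+1%:R^-1 -> U (x + y).
rewrite [X in measurable X](_ : _ = \bigcup_(p in good)
   ((ball (s p.1.1) p.2.+1%:R^-1 : set (borel V)) `*`
    (ball (s p.1.2) p.2.+1%:R^-1 : set (borel V)))); last first.
  apply/seteqP; split => [[x y]/= Uxy|[x y] [p gp []]]; last first.
    by rewrite -ball_normE /=; exact: gp.
  have /nbhs_ballP[e /= e0 xyU] : nbhs (x + y : V) U.
    by apply: open_nbhs_nbhs; split.
  (* The constant 4 counts two radii for each of the two coordinates. *)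
  have [n ne] : exists n, n.+1%:R^-1 < e / 4.
    have := near_infty_natSinv_lt (PosNum (divr_gt0 e0 (ltr0n _ 4))).
    by move=> [n _ /(_ n (leqnn _))]; exists n.
  have n0 : 0 < n.+1%:R^-1 :> R by rewrite invr_gt0.
  have [i ix] := sP x _ n0; have [j jy] := sP y _ n0.
  exists (i, j, n); last by rewrite -ball_normE.
  move=> x' y' /= ix' jy'; apply: xyU; rewrite -ball_normE /=.
  apply: lt_trans (norm_addB_lt4 ix jy ix' jy') _.
  by rewrite -ltr_pdivlMr.
rewrite bigcup_mkcond; apply: countable_bigcupT_measurable.
  exact: countableP.
move=> p; case: ifPn => // _; apply: measurableX;
  by apply: sub_sigma_algebra; exact: ball_open.
Qed.

Lemma borel_measurableD {R : realType} {V : normedModType R}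
    d (T : measurableType d) (f g : T -> borel V) :
  separable V -> measurable_fun setT f -> measurable_fun setT g ->
  measurable_fun setT ((fun t => (f t : V) + g t) : T -> borel V).
Proof.
move=> sV mf mg.
exact: (measurableT_comp (borel_add_measurable sV) (measurable_fun_pair mf mg)).
Qed.

Lemma borel_measurableN {R : realType} {V : normedModType R}
    d (T : measurableType d) (f : T -> borel V) :
  measurable_fun setT f ->
  measurable_fun setT ((fun t => - (f t : V)) : T -> borel V).
Proof.
apply: measurableT_comp; apply: borel_continuous_measurable.
exact: opp_continuous.
Qed.

(** * Conditional symmetry *)

(** Both sides are the integral over [A] of the mass that the common conditional
law of [X] and [- X] gives to [B]. *)
Lemma cond_symmetric_setE d (T : measurableType d) (R : realType)
    (P : probability T R) (V : completeNormedModType R)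
    (G : set (set T)) (X : T -> V) :
  sigma_algebra setT G -> G `<=` measurable -> cond_symmetric P G X ->
  forall (A : set T) (B : set (borel V)), G A -> measurable B ->
  P (A `&` X @^-1` B) = P (A `&` (fun t => - X t) @^-1` B).
Proof.
move=> sG Gm [k1 [k2 [c1 c2 k12]]] A B GA mB.
rewrite -(c1 _ _ GA mB) -(c2 _ _ GA mB).
have mk (k : R.-pker (g_sigma_algebraType G) ~> (borel V)) :
    measurable_fun A (fun t : T => k t B).
  move=> mA Y mY; apply: measurableI => //; apply: Gm.
  have := measurable_kernel k B mB measurableT Y mY.
  by rewrite setTI /measurable/= sigma_algebra_id.
apply: ae_eq_integral => //; first exact: Gm.
by apply: (@filterS _ _ (ae_filter_ringOfSetsType P) _ _ _ k12) => t
  /(_ _ mB) ->.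
Qed.

(** [X] and [Y] have the same law, since two finite measures that agree on a
generating pi-system are equal. *)
Lemma ge0_integral_pi_system d d' (T : measurableType d)
    (T' : measurableType d') (R : realType) (P : probability T R)
    (G : set (set T')) (X Y : T -> T') (h : T' -> \bar R) :
  measurable = <<s G >> -> setI_closed G -> G setT ->
  measurable_fun setT X -> measurable_fun setT Y ->
  (forall A, G A -> P (X @^-1` A) = P (Y @^-1` A)) ->
  measurable_fun setT h -> (forall z, 0 <= h z)%E ->
  (\int[P]_t h (X t) = \int[P]_t h (Y t))%E.
Proof.
move=> GE GI GT mX mY XY mh h0.
pose X' : {mfun T >-> T'} := HB.pack X (isMeasurableFun.Build _ _ _ _ _ mX).
pose Y' : {mfun T >-> T'} := HB.pack Y (isMeasurableFun.Build _ _ _ _ _ mY).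
have := @ge0_integral_distribution _ _ _ _ _ P X' h mh h0.
have := @ge0_integral_distribution _ _ _ _ _ P Y' h mh h0.
rewrite /comp /= => <- <-; apply: eq_measure_integral => A mA _.
apply: (@measure_unique _ _ _ G (fun=> setT)) => //.
- by rewrite bigcup_const.
- move=> _.
  by rewrite [ltLHS](@probability_setT _ _ _ (distribution P X')) ltry.
Qed.

(** The maps [t |-> (t, X t)] and [t |-> (t, - X t)] into [(T, G) * V] have the
same law, since by [cond_symmetric_setE] these laws agree on measurable
rectangles.  Equality on the whole product sigma-algebra is what permits
functions in which the past and the increment do not separate, such as
[|f n t + v|]. *)
Lemma cond_symmetric_integral d (T : measurableType d) (R : realType)
    (P : probability T R) (V : completeNormedModType R)
    (G : set (set T)) (X : T -> V) (h : T * V -> \bar R) :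
  sigma_algebra setT G -> G `<=` measurable -> cond_symmetric P G X ->
  measurable_fun setT (X : T -> borel V) ->
  measurable_fun setT (h : (g_sigma_algebraType G * borel V)%type -> \bar R) ->
  (forall z, 0 <= h z)%E ->
  (\int[P]_t h (t, X t) = \int[P]_t h (t, (- X t)%R))%E.
Proof.
move=> sG Gm symX mX mh h0.
pose TG := g_sigma_algebraType G.
have GE : @measurable _ TG = G by exact: sigma_algebra_id.
pose phi (Y : T -> borel V) (t : T) : (TG * borel V)%type := (t, Y t).
have mphi (Y : T -> borel V) : measurable_fun setT Y ->
    measurable_fun setT (phi Y).
  move=> mY; apply: measurable_fun_pair => // _ A.
  by rewrite setTI preimage_id GE => /Gm.
have mphi1 := mphi _ mX; have mphi2 := mphi _ (borel_measurableN mX).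
pose G0 := [set A `*` B | A in G & B in @measurable _ (borel V)].
apply: (@ge0_integral_pi_system _ _ T (TG * borel V)%type _ P G0
  (phi X) (phi (fun t => - X t)) h) => //.
- by rewrite measurable_prod_measurableType GE.
- move=> _ _ [A1 GA1 [B1 mB1 <-]] [A2 GA2 [B2 mB2 <-]].
  rewrite -setXI; exists (A1 `&` A2).
    by move: GA1 GA2; rewrite -GE; exact: measurableI.
  by exists (B1 `&` B2) => //; exact: measurableI.
- exists setT; first by rewrite -GE; exact: measurableT.
  by exists setT => //; rewrite setXTT.
- move=> _ [A1 GA1 [B1 mB1 <-]].
  exact: (cond_symmetric_setE sG Gm symX GA1 mB1).
Qed.

(** * The exponential supermartingale *)

Lemma filtration_le d (T : measurableType d) (F : nat -> set (set T))
    (m n : nat) : filtration F -> (m <= n)%N -> F m `<=` F n.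
Proof.
move=> [_ _ FS]; elim: n => [|n IH]; first by rewrite leqn0 => /eqP ->.
by rewrite leq_eqVlt ltnS => /predU1P[->//|/IH Fmn]; exact: subset_trans (FS n).
Qed.

Lemma measurable_wrtS d (T : measurableType d) (R : realType)
    (V : completeNormedModType R) (G H : set (set T)) (X : T -> V) :
  G `<=` H -> measurable_wrt G X -> measurable_wrt H X.
Proof.
move=> GH mX _ B mB; have := mX measurableT B mB.
exact: (sub_sigma_algebra2 GH).
Qed.

Lemma measurable_wrt_incr d (T : measurableType d) (R : realType)
    (V : completeNormedModType R) (F : nat -> set (set T)) (f : nat -> T -> V)
    (i n : nat) : separable V -> filtration F ->
  (forall n, measurable_wrt (F n) (f n)) -> (i <= n)%N ->
  measurable_wrt (F n) (incr f i).
Proof.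
move=> sV filF mf ilen.
have mfn j : (j <= n)%N -> measurable_wrt (F n) (f j).
  by move=> jn; apply: measurable_wrtS (mf j); exact: filtration_le.
apply: borel_measurableD => //; first exact: mfn.
by apply: borel_measurableN; apply: mfn; exact: leq_trans (leq_pred _) ilen.
Qed.

Lemma measurable_cosh {R : realType} : measurable_fun setT (@cosh R).
Proof.
apply: measurable_funM => //; apply: measurable_funD => //.
exact: measurableT_comp.
Qed.

Definition energy {d} {T : measurableType d} {R : realType}
    {V : completeNormedModType R}
    (f : nat -> T -> V) (n : nat) (t : T) : R :=
  \sum_(j < n) `|incr f j.+1 t| ^+ 2.

Definition cosh_process {d} {T : measurableType d} {R : realType}
    {V : completeNormedModType R}
    (f : nat -> T -> V) (D l : R) (n : nat) (t : T) : R :=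
  cosh (l * `|f n t|) * expR (- (l ^+ 2 * D ^+ 2 * energy f n t / 2)).

Lemma cosh_process_ge0 {d} {T : measurableType d} {R : realType}
    {V : completeNormedModType R}
    (f : nat -> T -> V) (D l : R) (n : nat) (t : T) :
  0 <= cosh_process f D l n t.
Proof. by rewrite mulr_ge0 ?expR_ge0// ltW// cosh_gt0. Qed.

Lemma measurable_wrtT d (T : measurableType d) (R : realType)
    (V : completeNormedModType R) (G : set (set T)) (X : T -> V) :
  G `<=` measurable -> measurable_wrt G X ->
  measurable_fun setT (X : T -> borel V).
Proof.
move=> Gm mX _ B mB; have := measurable_wrtS Gm mX measurableT mB.
by rewrite /measurable /= sigma_algebra_id//; exact: sigma_algebra_measurable.
Qed.

Lemma measurable_energy d (T : measurableType d) (R : realType)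
    (V : completeNormedModType R) (F : nat -> set (set T)) (f : nat -> T -> V)
    (n : nat) : separable V -> filtration F ->
  (forall n, measurable_wrt (F n) (f n)) ->
  measurable_fun setT (energy f n : g_sigma_algebraType (F n) -> R).
Proof.
move=> sV filF mf.
suff : forall m, (m <= n)%N ->
    measurable_fun setT (energy f m : g_sigma_algebraType (F n) -> R) by exact.
elim=> [_|m IH mn].
  by rewrite /energy; under eq_fun do rewrite big_ord0; exact: measurable_cst.
rewrite /energy; under eq_fun do rewrite big_ord_recr/=.
apply: measurable_funD; first exact: (IH (ltnW mn)).
apply: measurable_funX; apply: (measurableT_comp borel_norm_measurable).
exact: (measurable_wrt_incr sV filF mf mn).
Qed.

Lemma measurable_cosh_process d (T : measurableType d) (R : realType)
    (V : completeNormedModType R) (F : nat -> set (set T)) (f : nat -> T -> V)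
    (D l : R) (n : nat) : separable V -> filtration F ->
  (forall n, measurable_wrt (F n) (f n)) ->
  measurable_fun setT
    (cosh_process f D l n : g_sigma_algebraType (F n) -> R).
Proof.
move=> sV filF mf; apply: measurable_funM.
  apply: (measurableT_comp measurable_cosh); apply: measurable_funM => //.
  exact: (measurableT_comp borel_norm_measurable (mf n)).
apply: measurableT_comp => //; apply: measurableT_comp => //.
apply: measurable_funM => //; apply: measurable_funM => //.
exact: measurable_energy.
Qed.

Lemma measurable_fun_sub_sigma_algebra d (T : measurableType d) (R : realType)
    (G : set (set T)) (g : T -> R) : sigma_algebra setT G ->
  G `<=` measurable ->
  measurable_fun setT (g : g_sigma_algebraType G -> R) -> measurable_fun setT g.
Proof.
move=> sG Gm mg _ B mB; apply: Gm; have := mg measurableT B mB.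
by rewrite /measurable/= sigma_algebra_id.
Qed.

(** The supermartingale property, in the integrated form that the stopping
argument below uses.  It is proved after doubling: twice the left-hand side is
the integral of the sum over both signs of the increment, to which
[smooth2_cosh] applies pointwise. *)
Lemma cosh_process_step d (T : measurableType d) (R : realType)
    (P : probability T R) (V : completeNormedModType R)
    (F : nat -> set (set T)) (f : nat -> T -> V) (D l : R) (n : nat)
    (A : set T) : smooth2 V D -> 0 <= l -> separable V -> filtration F ->
  (forall n, measurable_wrt (F n) (f n)) ->
  cond_symmetric P (F n) (incr f n.+1) -> F n A ->
  (\int[P]_(t in A) (cosh_process f D l n.+1 t)%:E <=
   \int[P]_(t in A) (cosh_process f D l n t)%:E)%E.
Proof.
move=> smV l0 sV filF mf sym FA.
have [sigF Fm _] := filF.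
have mincr : measurable_fun setT (incr f n.+1 : T -> borel V).
  apply: measurable_wrtT (Fm n.+1) _.
  exact: (measurable_wrt_incr sV filF mf (leqnn _)).
(* [cond_symmetric_integral] integrates over the whole space, so the event [A]
   enters through the past weight [w]. *)
pose w t : R := \1_A t * expR (- (l ^+ 2 * D ^+ 2 * energy f n t / 2)).
pose h (z : T * V) : R := w z.1 * (cosh (l * `|f n z.1 + z.2|) *
  expR (- (l ^+ 2 * D ^+ 2 * `|z.2| ^+ 2 / 2))).
have w0 t : 0 <= w t by rewrite mulr_ge0 ?expR_ge0// indicE ler0n.
have h0 z : 0 <= h z.
  by rewrite mulr_ge0// mulr_ge0 ?expR_ge0// ltW// cosh_gt0.
have mw : measurable_fun setT (w : g_sigma_algebraType (F n) -> R).
  apply: measurable_funM.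
    by apply: measurable_indic; rewrite /measurable/= sigma_algebra_id.
  apply: measurableT_comp => //; apply: measurableT_comp => //.
  apply: measurable_funM => //; apply: measurable_funM => //.
  exact: measurable_energy.
have mh : measurable_fun setT
    (h : (g_sigma_algebraType (F n) * borel V)%type -> R).
  apply: measurable_funM; first exact: (measurableT_comp mw measurable_fst).
  apply: measurable_funM.
    apply: (measurableT_comp measurable_cosh); apply: measurable_funM => //.
    apply: (measurableT_comp borel_norm_measurable).
    apply: borel_measurableD => //.
    exact: (measurableT_comp (mf n) measurable_fst).
  apply: measurableT_comp => //; apply: measurableT_comp => //.
  apply: measurable_funM => //; apply: measurable_funM => //.
  apply: measurable_funX; apply: (measurableT_comp borel_norm_measurable).
  exact: measurable_snd.
have mhX (Y : T -> V) : measurable_fun setT (Y : T -> borel V) ->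
    measurable_fun setT (fun t => (h (t, Y t))%:E).
  move=> mY; apply/measurable_EFinP.
  apply: (measurableT_comp mh); apply: measurable_fun_pair => //.
  move=> _ B; rewrite setTI preimage_id /measurable/= sigma_algebra_id//.
  exact: Fm.
have next : (\int[P]_(t in A) (cosh_process f D l n.+1 t)%:E =
    \int[P]_t (h (t, incr f n.+1 t))%:E)%E.
  rewrite integral_mkcond; apply: eq_integral => t _.
  rewrite patchE /h /w indicE /=; case: ifP => _; last by rewrite !mul0r.
  rewrite mul1r /cosh_process /energy big_ord_recr/= /incr/= subrKC.
  congr (_%:E); rewrite [RHS]mulrCA -expRD; congr (_ * expR _).
  by rewrite -opprD -mulrDl -mulrDr.
have now : (\int[P]_(t in A) (cosh_process f D l n t)%:E =
    \int[P]_t (w t * cosh (l * `|f n t|))%:E)%E.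
  rewrite integral_mkcond; apply: eq_integral => t _.
  rewrite patchE /w indicE /=; case: ifP => _; last by rewrite !mul0r.
  by rewrite mul1r mulrC.
have now0 t : (0 <= (w t * cosh (l * `|f n t|))%:E)%E.
  by rewrite lee_fin mulr_ge0// ltW// cosh_gt0.
have mnow : measurable_fun setT (fun t => (w t * cosh (l * `|f n t|))%:E).
  apply/measurable_EFinP.
  apply: (measurable_fun_sub_sigma_algebra (sigF n) (Fm n)).
  apply: measurable_funM => //; apply: (measurableT_comp measurable_cosh).
  apply: measurable_funM => //.
  exact: (measurableT_comp borel_norm_measurable (mf n)).
have mhE : measurable_fun setT
    (EFin \o h : (g_sigma_algebraType (F n) * borel V)%type -> \bar R).
  exact/measurable_EFinP.
have flip := cond_symmetric_integral (sigF n) (Fm n) sym mincr mhE.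
rewrite next now -(@lee_pmul2l _ 2%:E)//.
rewrite !mule_natl !mule2n [X in (_ + X <= _)%E]flip//.
rewrite -!ge0_integralD//=.
- apply: ge0_le_integral => //=.
  + by move=> t _; rewrite adde_ge0// lee_fin.
  + by apply: emeasurable_funD; apply: mhX => //; exact: borel_measurableN.
  + by apply: emeasurable_funD.
  + move=> t _; rewrite -!EFinD lee_fin /h /= -[leLHS]mulrDr -[leRHS]mulrDr.
    rewrite ler_wpM2l// normrN -mulrDl.
    apply: le_trans (ler_wpM2r (expR_ge0 _)
      (smooth2_cosh (f n t) (incr f n.+1 t) smV l0)) _.
    by rewrite -!mulrA -expRD subrr expR0 mulr1 mulrDl mul1r.
- by move=> t _; rewrite lee_fin.
- exact: mhX.
- by move=> t _; rewrite lee_fin.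
- exact: mhX (borel_measurableN mincr).
Qed.

(** * Maximal inequality *)

Definition below {d} {T : measurableType d} {R : realType}
    {V : completeNormedModType R} (f : nat -> T -> V) (rho : R) (n : nat) :
    set T :=
  [set t | forall i, (i <= n)%N -> `|f i t| < rho].

Lemma below0 d (T : measurableType d) (R : realType)
    (V : completeNormedModType R) (f : nat -> T -> V) (rho : R) :
  below f rho 0 = [set t | `|f 0%N t| < rho].
Proof.
apply/seteqP; split => t /= ft; first exact: ft.
by move=> i; rewrite leqn0 => /eqP ->.
Qed.

Lemma belowS d (T : measurableType d) (R : realType)
    (V : completeNormedModType R) (f : nat -> T -> V) (rho : R) (n : nat) :
  below f rho n.+1 = below f rho n `&` [set t | `|f n.+1 t| < rho].
Proof.
apply/seteqP; split => t /= => [ft|[ft ftn] i].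
  by split; [move=> i ni; apply: ft; exact: leqW|exact: ft].
by rewrite leq_eqVlt ltnS => /predU1P[->//|]; exact: ft.
Qed.

Lemma below_in d (T : measurableType d) (R : realType)
    (V : completeNormedModType R) (F : nat -> set (set T)) (f : nat -> T -> V)
    (rho : R) (n : nat) : filtration F ->
  (forall n, measurable_wrt (F n) (f n)) -> F n (below f rho n).
Proof.
move=> filF mf; have [sF _ FS] := filF.
have Flt m : F m [set t | `|f m t| < rho].
  have := measurableT_comp borel_norm_measurable (mf m).
  move=> /(_ measurableT `]-oo, rho[%classic (measurable_itv _)).
  rewrite /measurable/= sigma_algebra_id// setTI.
  by congr (F m _); apply/seteqP; split => t /=; rewrite in_itv.
elim: n => [|n IH]; first by rewrite below0.
have -> : F n.+1 = @measurable _ (g_sigma_algebraType (F n.+1)).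
  by rewrite /measurable/= sigma_algebra_id.
rewrite belowS; apply: measurableI; rewrite /measurable/= sigma_algebra_id//.
exact: FS.
Qed.

(** Doob's maximal inequality.  Here [C n] is the event that the process has
not been stopped by time [n], and the left-hand side bounds from below the mean
of the stopped process.  It does not increase with [n]: the mass of [G] leaving
with [C n `\` C n.+1] is at least [k] times the probability of that event.  The
stopping events are kept abstract because they are defined by [f] and not by a
level of [G]. *)
Lemma nonneg_supermartingale_exit d (T : measurableType d) (R : realType)
    (P : probability T R) (G : nat -> T -> R) (C : nat -> set T) (k : R) :
  (forall n, measurable (C n)) -> (forall n, measurable_fun setT (G n)) ->
  (forall n t, 0 <= G n t) -> 0 <= k ->
  C 0%N = setT -> (forall t, G 0%N t = 1) -> (forall n, C n.+1 `<=` C n) ->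
  (forall n, \int[P]_(t in C n) (G n.+1 t)%:E <=
             \int[P]_(t in C n) (G n t)%:E)%E ->
  (forall n, {ae P, forall t, (C n `\` C n.+1) t -> k <= G n.+1 t}) ->
  forall n, (k%:E * P (~` C n) + \int[P]_(t in C n) (G n t)%:E <= 1)%E.
Proof.
move=> mC mG G0 k0 C0 G01 CS step hit; elim=> [|n IH].
  rewrite C0 setCT measure0 mule0 add0e.
  under eq_integral do rewrite G01.
  by rewrite integral_cst// mul1e probability_le1.
apply: le_trans IH.
have mGE m D : measurable_fun D (fun t => (G m t)%:E).
  by apply/measurable_EFinP; apply: measurable_funTS.
have split : ~` C n.+1 = ~` C n `|` (C n `\` C n.+1).
  by rewrite setDE setUIr setUCl setTI; apply/esym/setUidPr/subsetC.
have mB : measurable (C n `\` C n.+1) by exact: measurableD.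
have -> : P (~` C n.+1) = (P (~` C n) + P (C n `\` C n.+1))%E.
  rewrite split measureU//; first exact: measurableC.
  by rewrite setDE setIA setICl set0I.
rewrite muleDr ?ge0_adde_def ?inE// -addeA leeD2l//.
apply: le_trans (step n).
have {2}-> : C n = (C n `\` C n.+1) `|` C n.+1.
  by rewrite setUC setDUK.
rewrite ge0_integral_setU//; last 2 first.
  by move=> t _; rewrite lee_fin.
  by rewrite disj_set2E; apply/eqP; rewrite setDE -setIA setICl setI0.
rewrite leeD2r// -integral_cst//.
apply: ae_ge0_le_integral => //.
by move=> t _; rewrite lee_fin.
Qed.

Lemma energy_le_ae d (T : measurableType d) (R : realType)
    (P : probability T R) (V : completeNormedModType R) (f : nat -> T -> V)
    (b : R) : 0 < b -> ('N[P]_+oo[square_fun f] <= b%:E)%E ->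
  {ae P, forall t, forall n, energy f n t <= b ^+ 2}.
Proof.
move=> b0; rewrite unlock /Lnorm [X in (0 < X)%E](@probability_setT _ _ _ P).
rewrite lte01 => /ess_supP.
apply: (@filterS _ _ (ae_filter_ringOfSetsType P)) => t /= + n.
rewrite gee0_abs ?sqrte_ge0//.
have -> : b%:E = sqrte (b ^+ 2)%:E.
  by rewrite EFin_expe sqrte_sqr gee0_abs// lee_fin ltW.
rewrite lee_sqrt ?lee_fin ?sqr_ge0// => S2b.
rewrite -lee_fin; apply: le_trans S2b.
rewrite /energy -sumEFin.
rewrite -(big_mkord xpredT (fun j => (`|incr f j.+1 t| ^+ 2)%:E)).
have -> : (\sum_(0 <= j < n) (`|incr f j.+1 t| ^+ 2)%:E =
    \sum_(1 <= j < n.+1) (`|incr f j t| ^+ 2)%:E)%E.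
  by rewrite big_add1.
by apply: nneseries_lim_ge => j _ _; rewrite lee_fin sqr_ge0.
Qed.

(** At the first time that [|f|] reaches [rho], the process is at least
[k = exp (l rho) / 2 * exp (- l^2 D^2 b^2 / 2)], whose inverse is the bound. *)
Lemma exceedance_bound d (T : measurableType d) (R : realType)
    (P : probability T R) (V : completeNormedModType R)
    (F : nat -> set (set T)) (f : nat -> T -> V) (D l b rho : R) :
  smooth2 V D -> 0 <= l -> 0 < rho -> separable V -> filtration F ->
  (forall n, measurable_wrt (F n) (f n)) -> (forall t, f 0%N t = 0) ->
  (forall n, cond_symmetric P (F n) (incr f n.+1)) ->
  {ae P, forall t, forall n, energy f n t <= b ^+ 2} ->
  forall n, (P (~` below f rho n) <=
    (2 * expR (l ^+ 2 * D ^+ 2 * b ^+ 2 / 2 - l * rho))%:E)%E.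
Proof.
move=> smV l0 rho0 sV filF mf f0 sym fb n; have [sF Fm _] := filF.
pose k := expR (l * rho) / 2 * expR (- (l ^+ 2 * D ^+ 2 * b ^+ 2 / 2)).
have k0 : 0 < k by rewrite mulr_gt0 ?expR_gt0// divr_gt0 ?expR_gt0.
have kV : 2 * expR (l ^+ 2 * D ^+ 2 * b ^+ 2 / 2 - l * rho) = k^-1.
  rewrite /k !invfM invrK expRD -!expRN opprK; ring.
have mC m : measurable (below f rho m) by apply: (Fm m); exact: below_in.
have mG m : measurable_fun setT (cosh_process f D l m).
  apply: (measurable_fun_sub_sigma_algebra (sF m) (Fm m)).
  exact: measurable_cosh_process.
have C0 : below f rho 0 = setT.
  by rewrite below0; apply/seteqP; split => t //= _; rewrite f0 normr0.
have G01 t : cosh_process f D l 0 t = 1.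
  by rewrite /cosh_process /energy f0 normr0 big_ord0 !mulr0 mul0r oppr0 cosh0
    expR0 mulr1.
have CS m : below f rho m.+1 `<=` below f rho m.
  by rewrite belowS; exact: subIsetl.
have step m := cosh_process_step smV l0 sV filF mf (sym m)
  (below_in rho m filF mf).
have hit m : {ae P, forall t, (below f rho m `\` below f rho m.+1) t ->
    k <= cosh_process f D l m.+1 t}.
  apply: (@filterS _ _ (ae_filter_ringOfSetsType P) _ _ _ fb) => t fbt [ft].
  rewrite belowS => ftS.
  have {}ftS : rho <= `|f m.+1 t| by rewrite leNgt; apply/negP => ?; apply: ftS.
  rewrite ler_pM ?divr_ge0 ?expR_ge0//.
    apply: le_trans (expR_le_cosh _).
    by rewrite ler_pM2r ?invr_gt0// ler_expR ler_wpM2l.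
  rewrite ler_expR lerN2 ler_pM2r ?invr_gt0//.
  by rewrite ler_wpM2l// mulr_ge0// sqr_ge0.
have := nonneg_supermartingale_exit mC mG (cosh_process_ge0 f D l) (ltW k0) C0
  G01 CS step hit n.
move=> doob; rewrite kV -(@lee_pmul2l _ k%:E)// -EFinM divff ?gt_eqF//.
apply: le_trans doob; rewrite leeDl// integral_ge0// => t _.
by rewrite lee_fin cosh_process_ge0.
Qed.

(** Left continuity of the bound at [r]: otherwise
[p = K exp (- l r) exp q] with [q > 0], which contradicts the bound at
[r - s] as soon as [l s < q]. *)
Lemma le_expR_of_lt {R : realType} (p K l r : R) : 0 < K -> 0 <= l ->
  0 < r -> (forall rho, 0 < rho -> rho < r -> p <= K * expR (- (l * rho))) ->
  p <= K * expR (- (l * r)).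
Proof.
move=> K0 l0 r0 hp; rewrite leNgt; apply/negP => lt_p.
have Kr0 : 0 < K * expR (- (l * r)) by rewrite mulr_gt0 ?expR_gt0.
pose q := ln (p / (K * expR (- (l * r)))).
have q0 : 0 < q by rewrite ln_gt0// ltr_pdivlMr// mul1r.
pose s := Num.min (r / 2) (q / (2 * (l + 1))).
have l1 : 0 < 2 * (l + 1) by lra.
have s0 : 0 < s by rewrite lt_min !divr_gt0.
have sr : s <= r / 2 by rewrite ge_min lexx.
have sq : s * (2 * (l + 1)) <= q by rewrite -ler_pdivlMr// ge_min lexx orbT.
have rs0 : 0 < r - s by lra.
have rsr : r - s < r by lra.
have := hp _ rs0 rsr; apply/negP; rewrite -ltNge.
have -> : p = K * expR (- (l * r)) * expR q.
  rewrite lnK ?posrE ?divr_gt0 ?(lt_trans Kr0 lt_p)//.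
  by rewrite mulrCA divff ?mulr1// gt_eqF.
by rewrite -[ltRHS]mulrA -expRD ltr_pM2l// ltr_expR; nra.
Qed.

Lemma measurable_maximal d (T : measurableType d) (R : realType)
    (V : completeNormedModType R) (f : nat -> T -> V) :
  (forall n, measurable_fun setT (f n : T -> borel V)) ->
  measurable_fun setT (maximal f).
Proof.
move=> mf.
have := @measurable_fun_esups _ T R setT (fun n t => `|f n t|%:E) _ 0%N.
rewrite (_ : (fun t => _) = maximal f); last first.
  apply/funext => t; congr ereal_sup.
  by apply/seteqP; split => x [j _ <-]; exists j.
apply=> n; apply/measurable_EFinP.
exact: measurableT_comp borel_norm_measurable (mf n).
Qed.

Unset Implicit Arguments.
Set Strict Implicit.

Theorem theorem3p6 (R : realType) (V : completeNormedModType R) (D : R)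
    (D_gt0 : 0 < D) (V_smooth : smooth2 V D) (V_separable : separable V)
    (d : measure_display) (T : measurableType d) (P : probability T R)
    (F : nat -> set (set T)) (f : nat -> T -> V)
    (f_martingale : martingale P F f) (f0 : forall t, f 0%N t = 0)
    (b : R) (b_gt0 : 0 < b)
    (S2_le : ('N[P]_+oo[square_fun f] <= b%:E)%E)
    (f_sym : forall j : nat, (1 <= j)%N ->
       cond_symmetric P (F j.-1) (incr f j))
    (r : R) (r_ge0 : 0 <= r) :
  (P [set t | (r%:E <= maximal f t)%E]
     <= (2 * expR (- (r ^+ 2 / (2 * D ^+ 2 * b ^+ 2))))%:E)%E.
Proof.
have [filF mf _ _] := f_martingale; have [sF Fm _] := filF.
have sym n : cond_symmetric P (F n) (incr f n.+1) by exact: (f_sym n.+1).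
have mE : measurable [set t | (r%:E <= maximal f t)%E].
  rewrite -[X in measurable X]setTI; apply: emeasurable_fun_c_infty => //.
  by apply: measurable_maximal => n; exact: measurable_wrtT (Fm n) (mf n).
move: r_ge0; rewrite le_eqVlt => /predU1P[r0|r_gt0].
  rewrite -r0 in mE *; rewrite expr0n/= mul0r oppr0 expR0 mulr1.
  by apply: le_trans (probability_le1 _ mE) _; rewrite lee_fin ler1n.
set E := [set t | _] in mE *.
(* This [l] minimizes the exponent [l^2 D^2 b^2 / 2 - l r]. *)
pose l := r / (D ^+ 2 * b ^+ 2).
have l_gt0 : 0 < l by rewrite divr_gt0// mulr_gt0// exprn_gt0.
have bound rho : 0 < rho -> rho < r -> fine (P E) <=
    2 * expR (l ^+ 2 * D ^+ 2 * b ^+ 2 / 2) * expR (- (l * rho)).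
  move=> rho0 rhor.
  rewrite -lee_fin fineK ?fin_num_measure// -mulrA -expRD.
  have excl := exceedance_bound V_smooth (ltW l_gt0) rho0 V_separable
    filF mf f0 sym (energy_le_ae b_gt0 S2_le).
  have mC n : measurable (~` below f rho n).
    by apply: measurableC; apply: (Fm n); exact: below_in.
  have sub : E `<=` \bigcup_n ~` below f rho n.
    move=> t /= rt.
    have /ereal_sup_gt[_ [j _ <-]] : (rho%:E < maximal f t)%E.
      by apply: lt_le_trans rt; rewrite lte_fin.
    by rewrite lte_fin => fj; exists j => // /(_ j (leqnn j));
      rewrite ltNge ltW.
  have cvgP : P (~` below f rho n) @[n --> \oo] -->
      P (\bigcup_n ~` below f rho n).
    apply: nondecreasing_cvg_mu => //; first exact: bigcupT_measurable.
    apply/nondecreasing_seqP => n; apply/subsetPset/subsetC.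
    by rewrite belowS; exact: subIsetl.
  apply: (@le_trans _ _ (P (\bigcup_n ~` below f rho n))).
    by apply: le_measure => //; rewrite inE//; exact: bigcupT_measurable.
  have <- := cvg_lim (@ereal_hausdorff R) cvgP.
  apply: lime_le; first by apply/cvg_ex; eexists; exact: cvgP.
  by apply: nearW => n; exact: excl.
rewrite -(fineK (fin_num_measure P E mE)) lee_fin.
apply: le_trans (le_expR_of_lt _ (ltW l_gt0) r_gt0 bound) _.
  by rewrite mulr_gt0 ?expR_gt0.
rewrite -mulrA -expRD ler_pM2l// ler_expR le_eqVlt; apply/orP; left; apply/eqP.
by rewrite /l; field; rewrite ?gt_eqF.
Qed.
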